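(* Let $T\subset\mathbb R^3$ be the vertex set of an acute triangle. Then for every coloring of $\mathbb R^3$ (i.e., every function from $\mathbb R^3$ to an arbitrary set of colors, with no restriction on the number of colors), there exists a set $T'\subset\mathbb R^3$ congruent to $T$ (an isometric copy of $T$ under the Euclidean metric) such that either all three points of $T'$ have the same color, or all three points of $T'$ have pairwise distinct colors.
   Context: A copy of a set $A$ is monochromatic if all its points receive the same color, and rainbow if all its points receive pairwise distinct colors. *)

(* Defs.v *)
From HB Require Import structures.
From mathcomp Require Import all_boot all_order all_algebra.
From mathcomp Require Import all_classical all_reals all_analysis.

Set Implicit Arguments.
Unset Strict Implicit.
Unset Printing Implicit Defensive.

Import Order.TTheory GRing.Theory Num.Theory.

Local Open Scope classical_set_scope.
Local Open Scope ring_scope.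

Section Euclidean.
Variables (R : realType) (n : nat).
Implicit Types (u v x y a b c : 'rV[R]_n) (A B T : set 'rV[R]_n).

Definition dotp u v : R := \sum_(i < n) u 0 i * v 0 i.

(* The library norm on 'rV[R]_n is the sup norm, hence this definition. *)
Definition enorm u : R := Num.sqrt (dotp u u).

Definition edist x y : R := enorm (x - y).

Definition isometry (f : 'rV[R]_n -> 'rV[R]_n) : Prop :=
  forall x y, edist (f x) (f y) = edist x y.

(* Isometries of a finite-dimensional Euclidean space are bijective, so this
   relation is symmetric. *)
Definition congruent A B : Prop :=
  exists2 f : 'rV[R]_n -> 'rV[R]_n, isometry f & f @` A = B.

(* The angle at the vertex b; meaningful when a and c differ from b, in which
   case the argument of acos lies in [-1, 1] by Cauchy-Schwarz. *)
Definition angle a b c : R :=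
  acos (dotp (a - b) (c - b) / (enorm (a - b) * enorm (c - b))).

Definition triangle a b c : Prop := free [:: b - a; c - a].

Definition acute_triangle a b c : Prop :=
  [/\ triangle a b c,
      angle c a b < pi / 2, angle a b c < pi / 2 & angle b c a < pi / 2].

Definition acute_vertex_set T : Prop :=
  exists a b c, acute_triangle a b c /\ T = [set a; b; c].

End Euclidean.

Definition monochromatic (X C : Type) (chi : X -> C) (A : set X) : Prop :=
  forall x y, A x -> A y -> chi x = chi y.

Definition rainbow (X C : Type) (chi : X -> C) (A : set X) : Prop :=
  set_inj A chi.

(* Main.v *)
Require Import Defs.
From mathcomp Require Import all_boot all_order all_algebra.
From mathcomp Require Import all_classical all_reals all_analysis.
From mathcomp Require Import ring lra.

(* Restores [edist], which MathComp-Analysis uses for another function. *)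
Import Defs.
Import Order.TTheory GRing.Theory Num.Theory.

Local Open Scope classical_set_scope.
Local Open Scope ring_scope.

(** Suppose no copy of the triangle is monochromatic or rainbow. Since the
    triangle is acute, it is the common shape of the four faces of a
    tetrahedron, spanned by alternate vertices of a rectangular box. As every
    face carries exactly two colors, so does the tetrahedron, with two vertices
    of each color. Hence the colors of the vertices of one face determine the
    color of the fourth vertex, and so the fourth vertex and its mirror image in
    that face have the same color. If r is the distance between these two
    points, any two points at distance r have the same color. As any two points
    are joined by a chain of steps of length r, there is only one color. *)

Set Implicit Arguments.
Unset Strict Implicit.

(** * Inner products, reflections and congruence in Euclidean space *)

Section Euclidean_space.
Variables (R : realType) (n : nat).
Implicit Types (u v w x y z p q : 'rV[R]_n) (k : R).

Lemma dotpC u v : dotp u v = dotp v u.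
Proof. by apply: eq_bigr => i _; rewrite mulrC. Qed.

Lemma dotpDl u v w : dotp (u + v) w = dotp u w + dotp v w.
Proof. by rewrite -big_split; apply: eq_bigr => i _; rewrite !mxE mulrDl. Qed.

Lemma dotpZl k u v : dotp (k *: u) v = k * dotp u v.
Proof. by rewrite /dotp mulr_sumr; apply: eq_bigr => i _; rewrite !mxE mulrA. Qed.

Lemma dotpNl u v : dotp (- u) v = - dotp u v.
Proof. by rewrite -scaleN1r dotpZl mulN1r. Qed.

Lemma dotpDr u v w : dotp w (u + v) = dotp w u + dotp w v.
Proof. by rewrite dotpC dotpDl !(dotpC w). Qed.

Lemma dotpZr k u v : dotp u (k *: v) = k * dotp u v.
Proof. by rewrite dotpC dotpZl dotpC. Qed.

Lemma dotpNr u v : dotp u (- v) = - dotp u v.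
Proof. by rewrite dotpC dotpNl dotpC. Qed.

Definition dotpE := (dotpDl, dotpDr, dotpNl, dotpNr, dotpZl, dotpZr).

Lemma dotp_ge0 u : 0 <= dotp u u.
Proof. by apply: sumr_ge0 => i _; rewrite -expr2 sqr_ge0. Qed.

Lemma dotp_eq0 u : dotp u u = 0 -> u = 0.
Proof.
move=> /eqP; rewrite psumr_eq0 => [/allP u0|i _]; last by rewrite -expr2 sqr_ge0.
apply/rowP => i; rewrite mxE; apply/eqP.
by have := u0 i (mem_index_enum i); rewrite /= mulf_eq0 orbb.
Qed.

Lemma dotp_gt0 u : u != 0 -> 0 < dotp u u.
Proof.
move=> u0; rewrite lt_def dotp_ge0 andbT.
by apply: contra u0 => /eqP /dotp_eq0 ->.
Qed.

Lemma edist_eqP x y x' y' :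
  edist x y = edist x' y' <-> dotp (x - y) (x - y) = dotp (x' - y') (x' - y').
Proof.
split=> [/eqP|]; last by rewrite /edist /enorm => ->.
by rewrite eqr_sqrt ?dotp_ge0// => /eqP.
Qed.

Lemma isometry_comp (f g : 'rV[R]_n -> 'rV[R]_n) :
  isometry f -> isometry g -> isometry (f \o g).
Proof. by move=> fI gI x y; rewrite /= fI gI. Qed.

(** Cauchy-Schwarz: for [v] nonzero, the squared length of [dotp v v *: u - dotp u v *: v] is
    [dotp v v] times the Gram determinant of [u] and [v]. *)
Lemma dotp_le_enorm u v : `|dotp u v| <= enorm u * enorm v.
Proof.
rewrite -sqrtrM ?dotp_ge0// -sqrtr_sqr ler_wsqrtr//.
have := dotp_ge0 v; rewrite le_eqVlt => /predU1P[v0|v_gt0].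
  by rewrite (dotp_eq0 (esym v0)) -(scale0r 0) !dotpZr !mul0r expr0n mulr0.
have := dotp_ge0 (dotp v v *: u - dotp u v *: v); rewrite !dotpE (dotpC v u).
set a := dotp u u; set b := dotp u v; set c := dotp v v in v_gt0 *.
rewrite (_ : _ + _ = c * (a * c - b ^+ 2)); last by ring.
by rewrite pmulr_rge0// subr_ge0.
Qed.

(* For [p = q] the division by zero makes this the identity. *)
Definition bisector_refl p q z : 'rV[R]_n :=
  z - (dotp (z + z - p - q) (p - q) / dotp (p - q) (p - q)) *: (p - q).

Lemma bisector_refl_isometry p q : isometry (bisector_refl p q).
Proof.
move=> x y; apply/edist_eqP; rewrite /bisector_refl.
set w := p - q; set k := dotp w w.
have [k0|k0] := eqVneq k 0; first by rewrite k0 invr0 !mulr0 !scale0r !subr0.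
(* The translation part cancels, leaving the linear reflection of [x - y] in the hyperplane
   orthogonal to [w]. *)
have -> : x - (dotp (x + x - p - q) w / k) *: w -
    (y - (dotp (y + y - p - q) w / k) *: w) =
    (x - y) - (2 * dotp (x - y) w / k) *: w.
  by apply/rowP => i; rewrite !dotpE !mxE; ring.
move: k0; rewrite /k; clearbody w; move: (x - y) => u k0.
by rewrite !dotpE (dotpC w u); field.
Qed.

Lemma bisector_reflE p q : bisector_refl p q p = q.
Proof.
rewrite /bisector_refl addrK.
have [/eqP|pq0] := eqVneq (dotp (p - q) (p - q)) 0.
  by move=> /eqP /dotp_eq0 /eqP; rewrite subr_eq0 => /eqP ->; rewrite subrr scaler0 subr0.
by rewrite divff// scale1r subKr.
Qed.

Lemma bisector_refl_fix p q z :
  edist z p = edist z q -> bisector_refl p q z = z.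
Proof.
move=> /edist_eqP zpq; rewrite /bisector_refl (_ : dotp _ _ = 0).
  by rewrite mul0r scale0r subr0.
move: zpq; rewrite !dotpE !(dotpC _ z) (dotpC q p); lra.
Qed.

(** After [p] is reflected to [p'], the reflection taking the image of [q] to [q'] fixes [p'], which
    is equidistant from both. *)
Lemma congruent_pair p q p' q' : edist p q = edist p' q' ->
  exists f : 'rV[R]_n -> 'rV[R]_n, [/\ isometry f, f p = p' & f q = q'].
Proof.
move=> d; pose s1 := bisector_refl p p'; pose s2 := bisector_refl (s1 q) q'.
exists (s2 \o s1); split.
- by apply: isometry_comp; exact: bisector_refl_isometry.
- rewrite /= [s1 p]bisector_reflE [s2 _]bisector_refl_fix// -d.
  by rewrite -[in LHS](bisector_reflE p p') bisector_refl_isometry.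
- by rewrite /= [s2 _]bisector_reflE.
Qed.

Lemma congruent_triple p q r p' q' r' :
    edist p q = edist p' q' -> edist p r = edist p' r' ->
    edist q r = edist q' r' ->
  exists f : 'rV[R]_n -> 'rV[R]_n, [/\ isometry f, f p = p', f q = q' & f r = r'].
Proof.
move=> pq pr qr; have [f [fI fp fq]] := congruent_pair pq.
pose s := bisector_refl (f r) r'.
exists (s \o f); split.
- by apply: isometry_comp => //; exact: bisector_refl_isometry.
- by rewrite /= fp [s _]bisector_refl_fix// -pr -[in LHS]fp fI.
- by rewrite /= fq [s _]bisector_refl_fix// -qr -[in LHS]fq fI.
- by rewrite /= [s _]bisector_reflE.
Qed.

Lemma angle_lt_pihalf (a b c : 'rV[R]_n) :
  a != b -> c != b -> angle a b c < pi / 2 -> 0 < dotp (a - b) (c - b).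
Proof.
rewrite -(subr_eq0 a) -(subr_eq0 c) /angle => ab cb.
set u := a - b in ab *; set v := c - b in cb *.
have uv0 : 0 < enorm u * enorm v by rewrite mulr_gt0// sqrtr_gt0 dotp_gt0.
have t1 : -1 <= dotp u v / (enorm u * enorm v) <= 1.
  rewrite -ler_norml normrM normfV (gtr0_norm uv0) ler_pdivrMr// mul1r.
  exact: dotp_le_enorm.
move=> acute; suff: 0 < dotp u v / (enorm u * enorm v).
  by rewrite pmulr_lgt0 ?invr_gt0.
rewrite -(acosK t1).
apply: cos_gt0_pihalf; rewrite acute andbT (lt_le_trans _ (acos_ge0 t1))//.
by rewrite oppr_lt0 divr_gt0// pi_gt0.
Qed.

End Euclidean_space.

Section Space.
Variable R : realType.

Definition vec3 (x y z : R) : 'rV[R]_3 := \row_i [:: x; y; z]`_i.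

Lemma dotp_vec3 x y z x' y' z' :
  dotp (vec3 x y z) (vec3 x' y' z') = x * x' + y * y' + z * z'.
Proof. by rewrite /dotp !big_ord_recl big_ord0 !mxE /= addr0 addrA. Qed.

Lemma vec3B x y z x' y' z' :
  vec3 x y z - vec3 x' y' z' = vec3 (x - x') (y - y') (z - z').
Proof. by apply/rowP => -[[|[|[|//]]] ?]; rewrite !mxE. Qed.

Lemma vec3D x y z x' y' z' :
  vec3 x y z + vec3 x' y' z' = vec3 (x + x') (y + y') (z + z').
Proof. by apply/rowP => -[[|[|[|//]]] ?]; rewrite !mxE. Qed.

Lemma vec3_surj (v : 'rV[R]_3) : exists x y z, v = vec3 x y z.
Proof.
exists (v 0 0), (v 0 1), (v 0 (inord 2)); apply/rowP => -[[|[|[|//]]] i3];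
  rewrite !mxE /=; congr (v 0 _); apply: val_inj => //=; rewrite inordK//.
Qed.

(** * Colorings that are constant on pairs at distance [r] *)

Section Step.
Variables (C : Type) (chi : 'rV[R]_3 -> C) (r : R).
Hypothesis r_gt0 : 0 < r.
Hypothesis step : forall p q, edist p q = r -> chi p = chi q.

Let period v := forall p, chi (p + v) = chi p.

Let period_step v : dotp v v = r ^+ 2 -> period v.
Proof.
move=> vr p; apply: step; rewrite /edist addrC addKr.
by rewrite /enorm vr sqrtr_sqr gtr0_norm.
Qed.

Let periodD v w : period v -> period w -> period (v + w).
Proof. by move=> pv pw p; rewrite addrA pw pv. Qed.

Let period_mulrn v m : period v -> period (v *+ m).
Proof.
move=> pv; elim: m => [|m IH]; first by move=> p; rewrite mulr0n addr0.
by rewrite mulrS; exact: periodD.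
Qed.

(* Two steps forming an isosceles triangle of base [2 w]. *)
Let period_base v w : dotp v w = 0 -> dotp w w = 1 -> dotp v v <= r ^+ 2 ->
  period (v *+ 2).
Proof.
move=> vw w1 vr; pose s := Num.sqrt (r ^+ 2 - dotp v v).
have s2 : s ^+ 2 = r ^+ 2 - dotp v v by rewrite sqr_sqrtr// subr_ge0.
rewrite (_ : v *+ 2 = (v + s *: w) + (v - s *: w)); last by rewrite addrACA subrr addr0.
by apply: periodD; apply: period_step; rewrite !dotpE (dotpC w v) vw w1; move: s2; lra.
Qed.

Let period_line v w : dotp v w = 0 -> dotp w w = 1 -> period v.
Proof.
(* As [m] exceeds [dotp v v / r ^+ 2] and is at least 1, the vector [v / (2 m)] is shorter than [r],
   so its double is a period. *)
move=> vw w1; pose m := (Num.truncn (dotp v v / r ^+ 2)).+1.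
have m0 : (0 : R) < m%:R by rewrite ltr0n.
rewrite (_ : v = (((m.*2%:R)^-1 *: v) *+ 2) *+ m).
  apply: period_mulrn; apply: (period_base (w := w)) => //; rewrite !dotpE ?vw ?mulr0//.
  have m1 : (1 : R) <= m%:R by rewrite ler1n.
  have : dotp v v / r ^+ 2 < m%:R by exact: truncnS_gt.
  rewrite ltr_pdivrMr ?exprn_gt0// => vm.
  rewrite mulrA -expr2 exprVn mulrC ler_pdivrMr ?exprn_gt0 ?ltr0n ?double_gt0//.
  rewrite -mul2n natrM; have := exprn_gt0 2 r_gt0; nra.
by rewrite -mulrnA -scaler_nat scalerA mul2n divff ?scale1r// pnatr_eq0.
Qed.

Lemma one_color p q : chi p = chi q.
Proof.
suff /(_ (p - q) q) : forall v, period v by rewrite addrC subrK.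
move=> v; have [x [y [z ->]]] := vec3_surj v.
(* Each summand is orthogonal to a coordinate unit vector, as [period_line] requires. *)
have -> : vec3 x y z = vec3 x y 0 + vec3 0 0 z by rewrite vec3D !addr0 !add0r.
by apply: periodD; [apply: (period_line (w := vec3 0 0 1))|apply: (period_line (w := vec3 1 0 0))];
  rewrite dotp_vec3; ring.
Qed.

End Step.
End Space.

(** * Two tetrahedra glued along a face, and the theorem *)

Definition two_colors (C : Type) (a b c : C) :=
  (a = b \/ a = c \/ b = c) /\ ~ (a = b /\ b = c).

(** The apexes [c0] and [c4] both take the color that occurs only once in the shared face [c1],
    [c2], [c3]. Arguments are ordered so that each face matches the vertices of the triangle in
    order. *)
Lemma two_colors_apex (C : Type) (c0 c1 c2 c3 c4 : C) :
  two_colors c0 c1 c2 -> two_colors c1 c0 c3 -> two_colors c2 c3 c0 ->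
  two_colors c3 c2 c1 ->
  two_colors c4 c1 c2 -> two_colors c1 c4 c3 -> two_colors c2 c3 c4 -> c0 = c4.
Proof.
move=> [e1 n1] [e2 n2] [e3 n3] [e4 n4] [e5 n5] [e6 n6] [e7 n7].
by case: e1 => [|[|]] ?; case: e2 => [|[|]] ?; case: e3 => [|[|]] ?;
  case: e5 => [|[|]] ?; case: e6 => [|[|]] ?; case: e7 => [|[|]] ?; subst;
  tauto.
Qed.

Theorem theorem2 (R : realType) (T : set 'rV[R]_3)
    (hT : acute_vertex_set T) (C : Type) (chi : 'rV[R]_3 -> C) :
  exists T' : set 'rV[R]_3,
    congruent T T' /\ (monochromatic chi T' \/ rainbow chi T').
Proof.
case: hT => a [b [c [[tri angA angB angC] ->]]].
apply: contrapT => noT'.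
have two p q r : edist a b = edist p q -> edist a c = edist p r ->
    edist b c = edist q r ->
    two_colors (chi p) (chi q) (chi r).
  move=> ab ac bc.
  have pqr : congruent [set a; b; c] [set p; q; r].
    have [f [fI fa fb fc]] := congruent_triple ab ac bc.
    by exists f => //; rewrite !image_setU !image_set1 fa fb fc.
  split.
    apply: contrapT => /not_orP[pq /not_orP[pr qr]].
    apply: noT'; exists [set p; q; r]; split=> //; right.
    by move=> u v /set_mem[[->|->]|->] /set_mem[[->|->]|->] // /esym.
  move=> [pq qr]; apply: noT'; exists [set p; q; r]; split=> //; left.
  by move=> u v [[->|->]|->] [[->|->]|->]; rewrite ?pq ?qr.
have [ba ca bc] : [/\ b != a, c != a & b != c].
  have := free_uniq tri; rewrite /= andbT inE (can_eq (subrK _)) => bc.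
  by split=> //; rewrite -subr_eq0; apply: (free_not0 tri); rewrite !inE eqxx ?orbT.
(* These solve [x2 + y2 = |ab|^2], [x2 + z2 = |ac|^2], [y2 + z2 = |bc|^2]; acute angles make them
   positive, hence squares of box edges. *)
pose x2 := dotp (b - a) (c - a).
pose y2 := dotp (a - b) (c - b).
pose z2 := dotp (a - c) (b - c).
have x2_gt0 : 0 < x2 by rewrite /x2 dotpC; apply: angle_lt_pihalf.
have y2_gt0 : 0 < y2 by apply: angle_lt_pihalf; rewrite // eq_sym.
have z2_gt0 : 0 < z2 by rewrite /z2 dotpC; apply: angle_lt_pihalf; rewrite // eq_sym.
pose x : R := Num.sqrt x2; pose y : R := Num.sqrt y2.
pose z : R := Num.sqrt z2.
have x0 : 0 < x by rewrite sqrtr_gt0.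
have y0 : 0 < y by rewrite sqrtr_gt0.
have z0 : 0 < z by rewrite sqrtr_gt0.
have abE : dotp (a - b) (a - b) = x ^+ 2 + y ^+ 2.
  rewrite !sqr_sqrtr ?ltW// /x2 /y2 !dotpE ?(dotpC b a) ?(dotpC c a) ?(dotpC c b); ring.
have acE : dotp (a - c) (a - c) = x ^+ 2 + z ^+ 2.
  rewrite !sqr_sqrtr ?ltW// /x2 /z2 !dotpE ?(dotpC b a) ?(dotpC c a) ?(dotpC c b); ring.
have bcE : dotp (b - c) (b - c) = y ^+ 2 + z ^+ 2.
  rewrite !sqr_sqrtr ?ltW// /y2 /z2 !dotpE ?(dotpC b a) ?(dotpC c a) ?(dotpC c b); ring.
pose p0 := vec3 (0 : R) 0 0; pose p1 := vec3 x y 0.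
pose p2 := vec3 x 0 z; pose p3 := vec3 0 y z.
(* The squared length of the normal [(y z, x z, x y)] to the plane of [p1], [p2], [p3]. *)
pose d : R := (y * z) ^+ 2 + (x * z) ^+ 2 + (x * y) ^+ 2.
have d_gt0 : 0 < d by rewrite !addr_gt0 ?exprn_gt0 ?mulr_gt0.
pose k : R := 4 * x * y * z / d.
(* The mirror image of [p0] in the plane [X / x + Y / y + Z / z = 2]. *)
pose p4 := vec3 (k * (y * z)) (k * (x * z)) (k * (x * y)).
have k_gt0 : 0 < k by rewrite divr_gt0// !mulr_gt0.
have p04 : 0 < edist p0 p4.
  rewrite sqrtr_gt0 vec3B dotp_vec3 !sub0r !mulrNN -!expr2.
  by rewrite !addr_gt0// exprn_gt0// mulr_gt0// mulr_gt0.
(* Exactly what makes [p4] as far as [p0] from each of [p1], [p2], [p3]. *)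
have kd : k * (k * d) = k * (4 * x * y * z) by rewrite [X in k * X]divfK ?gt_eqF.
apply: noT'; exists [set a; b; c]; split.
  by exists id => //; rewrite image_id.
left=> ? ? _ _; apply: (one_color p04) => p q /esym.
(* The isometry [f] carries both tetrahedra so that their apexes land on [p] and [q]. *)
move=> /congruent_pair[f [fI <- <-]].
apply: (@two_colors_apex _ _ (chi (f p1)) (chi (f p2)) (chi (f p3))); apply: two;
  rewrite fI; apply/edist_eqP; rewrite ?abE ?acE ?bcE !vec3B dotp_vec3;
  clearbody x y z k; move: kd; rewrite /d; lra.
Qed.
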